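(* Let $p,r\geq1$ and $n\geq2$. Then $\Delta(O\Gamma_{n}^{(p,r)})=\Delta(I\Gamma_{n}^{(p,r)})=n$ and $d_{O\Gamma_{n}^{(p,r)}}(0^{n})=d_{I\Gamma_{n}^{(p,r)}}(0^{n})=n$. Moreover, $0^{n}$ is the only vertex of degree $\Delta(O\Gamma_{n}^{(p,r)})$ in $O\Gamma_{n}^{(p,r)}$ if and only if one of the following holds: (a) $p\geq1$, $r=1$ and $n\geq2$; (b) $p\geq2$, $r\geq2$ and $n\geq2$. And $0^{n}$ is the only vertex of degree $\Delta(I\Gamma_{n}^{(p,r)})$ in $I\Gamma_{n}^{(p,r)}$ if and only if one of the following holds: (a') $p\geq1$, $r=1$ and $n\geq2$; (b') $p\geq2$, $r=2$ and $n\geq 4$; (c') $p\geq2$, $r\geq3$ and $n\geq 5$.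
   Context: For positive integers $n,p,r$: $O\Gamma_{n}^{(p,r)}$ is the graph whose vertices are the binary words of length $n$ in which any two $1$s are separated by at least $p-1$ zeros and which contain no factor $(10^{p-1})^{r}1$ (no more than $r$ ones each separated from the next by exactly $p-1$ zeros); $I\Gamma_{n}^{(p,r)}$ is the graph whose vertices are the binary words of length $n$ in which every maximal block of consecutive $1$s has length at most $r$ and any two distinct blocks of $1$s are separated by at least $p$ zeros. In both, two vertices are adjacent iff they differ in exactly one coordinate. $\Delta(G)$ is the maximum degree, $d_G(v)$ the degree of $v$, and $0^n$ the all-zero word of length $n$. *)

(* Defs.v *)
From mathcomp Require Import all_boot.

Set Implicit Arguments.
Unset Strict Implicit.
Unset Printing Implicit Defensive.

Record sgraph := SGraph {
  vertex :> finType;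
  edge : rel vertex;
  edge_sym : symmetric edge;
  edge_irrefl : irreflexive edge
}.

Definition degree (G : sgraph) (v : G) : nat := #|[set u : G | edge v u]|.

Definition max_degree (G : sgraph) : nat := \max_(v : G) degree v.

(* Binary words of length n are n.-tuple bool, with true for 1. *)
Section Words.
Variable n : nat.
Implicit Types w : n.-tuple bool.

Definition zero_word : n.-tuple bool := [tuple of nseq n false].

Definition zeros_between w (i j : 'I_n) : nat :=
  #|[set k : 'I_n | (i < k < j) && ~~ tnth w k]|.

Definition adjacent_words w1 w2 : bool :=
  #|[set i : 'I_n | tnth w1 i != tnth w2 i]| == 1.

(* The word (1 0^(p-1))^r 1. *)
Definition forbidden_factor (p r : nat) : seq bool :=
  rcons (flatten (nseq r (true :: nseq p.-1 false))) true.

Definition O_word (p r : nat) w : bool :=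
  [forall i : 'I_n, forall j : 'I_n,
     [&& i < j, tnth w i & tnth w j] ==> (p.-1 <= zeros_between w i j)]
  && ~~ infix (forbidden_factor p r) w.

(* Positions i, ..., j (both included) are all occupied by 1s. *)
Definition is_run w (i j : 'I_n) : bool :=
  (i <= j) && [forall k : 'I_n, (i <= k <= j) ==> tnth w k].

Definition is_block w (i j : 'I_n) : bool :=
  is_run w i j &&
  [forall i' : 'I_n, forall j' : 'I_n,
     [&& i' <= i, j <= j' & is_run w i' j'] ==> (i' == i) && (j' == j)].

(* Distinct blocks are disjoint, so of two distinct blocks one, [i1, j1],
   ends before the other, [i2, j2], starts. *)
Definition I_word (p r : nat) w : bool :=
  [forall i : 'I_n, forall j : 'I_n, is_block w i j ==> (j - i + 1 <= r)]
  && [forall i1 : 'I_n, forall j1 : 'I_n, forall i2 : 'I_n, forall j2 : 'I_n,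
        [&& is_block w i1 j1, is_block w i2 j2 & j1 < i2]
          ==> (p <= zeros_between w j1 i2)].

Lemma adjacent_words_sym : symmetric adjacent_words.
Proof.
move=> w1 w2; rewrite /adjacent_words; congr (_ == 1).
by apply: eq_card => i; rewrite !inE eq_sym.
Qed.

Lemma adjacent_words_irrefl : irreflexive adjacent_words.
Proof.
move=> w; rewrite /adjacent_words (_ : [set i | _] = set0) ?cards0 //.
by apply/setP => i; rewrite !inE eqxx.
Qed.

Lemma tnth_zero_word (i : 'I_n) : tnth zero_word i = false.
Proof. by rewrite (tnth_nth false) /= nth_nseq if_same. Qed.

Lemma is_block_zero_word (i j : 'I_n) : is_block zero_word i j = false.
Proof.
apply/negP => /andP[/andP[le_ij /forallP/(_ i)]].
by rewrite leqnn le_ij tnth_zero_word.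
Qed.

Lemma O_word_zero (p r : nat) : O_word p r zero_word.
Proof.
apply/andP; split.
  by do 2!apply/forallP => ?; rewrite tnth_zero_word andbF.
apply/negP => /mem_infix/(_ true).
by rewrite mem_rcons inE eqxx mem_nseq andbF => /(_ isT).
Qed.

Lemma I_word_zero (p r : nat) : I_word p r zero_word.
Proof.
apply/andP; split; first by do 2!apply/forallP => ?; rewrite is_block_zero_word.
by do 4!apply/forallP => ?; rewrite is_block_zero_word.
Qed.

End Words.

(* The subgraph of the n-cube induced by the words satisfying P. *)
Definition word_graph (n : nat) (P : pred (n.-tuple bool)) : sgraph :=
  @SGraph {w : n.-tuple bool | P w}
    (fun u v => adjacent_words (val u) (val v))
    (fun u v => adjacent_words_sym (val u) (val v))
    (fun u => adjacent_words_irrefl (val u)).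

Definition OGamma (n p r : nat) : sgraph := word_graph (@O_word n p r).

Definition IGamma (n p r : nat) : sgraph := word_graph (@I_word n p r).

Definition O_zero (n p r : nat) : OGamma n p r :=
  exist (fun w => O_word p r w) (zero_word n) (O_word_zero n p r).

Definition I_zero (n p r : nat) : IGamma n p r :=
  exist (fun w => I_word p r w) (zero_word n) (I_word_zero n p r).

(* Main.v *)
Require Import Defs.
From mathcomp Require Import all_boot.
From mathcomp Require Import zify_ssreflect.

Set Implicit Arguments.
Unset Strict Implicit.
Unset Printing Implicit Defensive.

(** A vertex v has at most n neighbours, the words obtained by flipping one
    coordinate, and its degree is n iff all n flips are legal.  This holds for
    the zero word.  If it holds for v and v has a 1 at a, then flipping
    positions next to a, or at distance 2 from a, produces one of the forbidden
    patterns 11, 111 or 101.  This fails only for p = 1 < r, where 10^(n-1) has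
    degree n in both graphs, and for 1 < r and n small, where 01, 010 or (if
    2 < r) 0110 has degree n in the I-graph. *)

(** * Degrees as numbers of legal flips *)

Section Flip.
Variable n : nat.
Implicit Types w : n.-tuple bool.

Definition flip w (i : 'I_n) : n.-tuple bool :=
  [tuple (k == i) (+) tnth w k | k < n].

Lemma nth_true_lt w a : nth false w a -> a < n.
Proof.
by apply: contraLR; rewrite -leqNgt => ?; rewrite nth_default ?size_tuple.
Qed.

Lemma nth_flip w (i : 'I_n) k :
  nth false (flip w i) k = (k == i) (+) nth false w k.
Proof.
have [lt_kn | le_nk] := ltnP k n.
  by rewrite -(tnth_nth false (flip w i) (Ordinal lt_kn)) tnth_mktuple
             (tnth_nth false).
rewrite !nth_default ?size_tuple // addbF; symmetry; apply/negbTE.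
by rewrite gtn_eqF // (leq_trans _ le_nk).
Qed.

Lemma flip_inj w : injective (flip w).
Proof.
move=> i j eq_ij; apply: val_inj => /=; apply/eqP.
have := nth_flip w j i; rewrite -eq_ij nth_flip eqxx.
by move/addIb => <-.
Qed.

Lemma adjacent_flipP w w' :
  reflect (exists i, w' = flip w i) (adjacent_words w w').
Proof.
apply: (iffP cards1P) => [[i /setP diff_i] | [i ->]]; exists i.
  apply: eq_from_tnth => k; rewrite tnth_mktuple.
  have := diff_i k; rewrite !inE => <-.
  by case: (tnth w k) (tnth w' k) => [] [].
apply/setP => k; rewrite !inE tnth_mktuple.
by case: (k == i) (tnth w k) => [] [].
Qed.

(** Adjacent words are exactly the flips, and [flip] is injective in the position; so vertices and
    positions have the same image among all words. *)
Lemma degree_word_graph (P : pred (n.-tuple bool)) (v : word_graph P) :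
  degree v = #|[set i | P (flip (val v) i)]|.
Proof.
rewrite -(card_imset _ (@flip_inj (val v))) /degree.
rewrite -(card_imset [set u | edge v u] val_inj).
apply: eq_card => w; apply/imsetP/imsetP => [[u] | [i]].
  rewrite inE => /adjacent_flipP[i def_u] ->; exists i => //.
  by rewrite inE -def_u (valP u).
rewrite inE => Pi ->; exists (exist (fun w => P w) _ Pi) => //.
by rewrite inE; apply/adjacent_flipP; exists i.
Qed.

Lemma degree_eq_n (P : pred (n.-tuple bool)) (v : word_graph P) :
  degree v = n <-> forall i, P (flip (val v) i).
Proof.
rewrite degree_word_graph; split=> [full i | all_flips].
  have /eqP/setP/(_ i) : [set i | P (flip (val v) i)] == setT.
    by rewrite eqEcard subsetT cardsT card_ord full leqnn.
  by rewrite !inE.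
rewrite -[RHS]card_ord -cardsT; apply: eq_card => i.
by rewrite !inE all_flips.
Qed.

Lemma max_degree_eq_n (P : pred (n.-tuple bool)) (v : word_graph P) :
  degree v = n -> max_degree (word_graph P) = n.
Proof.
move=> deg_v; apply/eqP; rewrite eqn_leq; apply/andP; split.
  apply/bigmax_leqP => u _; rewrite degree_word_graph.
  by rewrite -[leqRHS]card_ord max_card.
by rewrite -{1}deg_v; apply: (leq_bigmax v).
Qed.

(** Moves uniqueness of the vertex of degree n from the subtype of vertices to plain words. *)
Lemma unique_degree_eq_n (P : pred (n.-tuple bool)) (z : word_graph P) :
    degree z = n ->
  (forall v : word_graph P, degree v = n <-> v = z) <->
  (forall w, P w -> (forall i, P (flip w i)) -> w = val z).
Proof.
move=> deg_z; split=> [uniq_z w Pw all_flips | uniq_z v].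
  have /uniq_z <- // : degree (exist (fun w => P w) w Pw : word_graph P) = n.
  exact/degree_eq_n.
split=> [/degree_eq_n all_flips | -> //].
by apply: val_inj; apply: uniq_z => //; apply: (valP v).
Qed.

Lemma nth_zero_word k : nth false (zero_word n) k = false.
Proof. by rewrite nth_nseq if_same. Qed.

Lemma eq_zero_word w : (forall k, ~~ nth false w k) -> w = zero_word n.
Proof.
move=> w0; apply: eq_from_tnth => k.
by rewrite tnth_zero_word (tnth_nth false); apply/negbTE.
Qed.

Lemma flip_zero_neq (i : 'I_n) : flip (zero_word n) i <> zero_word n.
Proof.
move/(congr1 (fun w : n.-tuple bool => nth false w i)).
by rewrite nth_flip nth_zero_word eqxx.
Qed.

Lemma count_zero_word : count id (zero_word n) = 0.
Proof. by rewrite /= count_nseq mul0n. Qed.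

(** With the count written as a sum over coordinates, only the term at [i] changes, by at most
    one. *)
Lemma count_flip w i : count id (flip w i) <= (count id w).+1.
Proof.
have countE u : count id (tval u) = \sum_(k < n) tnth u k.
  rewrite -sum1_count big_mkcond big_tuple.
  by apply: eq_bigr => k _; case: (tnth u k).
rewrite !countE (bigD1 i) //= [in leqRHS](bigD1 i) //=.
rewrite (eq_bigr (fun k => tnth w k : nat)) => [|k /negbTE ne_ki].
  by rewrite tnth_mktuple eqxx; case: (tnth w i); lia.
by rewrite tnth_mktuple ne_ki.
Qed.

End Flip.

(** * Words of the O-graph *)

Section OWords.
Variables (n p r : nat).
Implicit Types w : n.-tuple bool.

Lemma count_forbidden_factor : count id (forbidden_factor p r) = r.+1.
Proof.
rewrite /forbidden_factor -cats1 count_cat count_flatten map_nseq sumn_nseq /=.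
by rewrite count_nseq; lia.
Qed.

(** A factor is a subsequence, and the forbidden one carries r + 1 ones. *)
Lemma forbidden_factorN w :
  count id w <= r -> ~~ infix (forbidden_factor p r) w.
Proof.
move=> le_wr; apply/negP => /infixW/(leq_count_subseq id).
by rewrite count_forbidden_factor ltnNge le_wr.
Qed.

Lemma O_word_flip_zero (i : 'I_n) : 0 < r -> O_word p r (flip (zero_word n) i).
Proof.
move=> r_gt0; apply/andP; split; last first.
  apply: forbidden_factorN.
  by rewrite (leq_trans (count_flip _ _)) ?count_zero_word.
apply/forallP => j; apply/forallP => k; apply/implyP.
rewrite !(tnth_nth false) !nth_flip !nth_zero_word !addbF.
by case/and3P => lt_jk /eqP eq_ji /eqP eq_ki; rewrite eq_ji eq_ki ltnn in lt_jk.
Qed.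

Lemma O_word_count w : p = 1 -> count id w <= r -> O_word p r w.
Proof.
move=> p1 le_wr; rewrite /O_word forbidden_factorN // andbT.
by do 2!apply/forallP => ?; rewrite p1 implybT.
Qed.

(** No zero lies between adjacent ones, which forces p - 1 = 0; the forbidden factor for r = 1 is
    then 11 itself. *)
Lemma O_word_adjacent_ones w a :
  O_word p r w -> nth false w a -> nth false w a.+1 -> p <= 1 /\ r <> 1.
Proof.
case/andP => /forallP sep_w no_fact wa wa1.
have lt_a1 : a.+1 < n := nth_true_lt wa1.
have lt_a : a < n by apply: ltnW.
have le_p1 : p <= 1.
  have /forallP/(_ (Ordinal lt_a1))/implyP := sep_w (Ordinal lt_a).
  rewrite !(tnth_nth false) /= ltnSn wa wa1 => /(_ isT).
  rewrite /zeros_between (_ : [set _ | _] = set0) ?cards0; first by lia.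
  by apply/setP => k; rewrite !inE /=; apply/negbTE/negP; lia.
split=> // r1.
move/negP: no_fact; apply; apply/infixP.
exists (take a w), (drop a.+2 w); rewrite r1 /forbidden_factor.
rewrite (_ : p.-1 = 0) /=; last by lia.
rewrite -{1}(cat_take_drop a w) (drop_nth false) ?size_tuple // wa.
by rewrite (drop_nth false) ?size_tuple // wa1.
Qed.

(** The pattern 11 is illegal here. A 1 has a neighbouring position since n > 1, and this position
    is a 1 already or becomes one by a flip. *)
Lemma O_all_flips w : 1 < n -> (1 < p \/ r = 1) ->
  O_word p r w -> (forall i, O_word p r (flip w i)) -> w = zero_word n.
Proof.
move=> n_gt1 pr Ow all_flips; apply: eq_zero_word => a; apply/negP => wa.
have lt_an := nth_true_lt wa.
have no11 (u : n.-tuple bool) b :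
    O_word p r u -> nth false u b -> nth false u b.+1 -> False.
  by move=> Ou ub ub1; have := O_word_adjacent_ones Ou ub ub1; lia.
have [lt_a1 | a_max] := ltnP a.+1 n.
  case wa1: (nth false w a.+1); first exact: (no11 w a).
  apply: (no11 _ a (all_flips (Ordinal lt_a1))); rewrite nth_flip /=.
    by rewrite ltn_eqF.
  by rewrite eqxx wa1.
(* The 1 is in the last position, so its left neighbour is used. *)
case: a => [|a] in wa lt_an a_max *; first by lia.
case wa1: (nth false w a); first exact: (no11 w a).
apply: (no11 _ a (all_flips (Ordinal (ltnW lt_an)))); rewrite nth_flip /=.
  by rewrite eqxx wa1.
by rewrite gtn_eqF.
Qed.

End OWords.

(** * Words of the I-graph: runs and blocks *)

Section IWords.
Variables (n p r : nat).
Implicit Types w : n.-tuple bool.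

Lemma run_nth w (i j : 'I_n) k : is_run w i j -> i <= k <= j -> nth false w k.
Proof.
case/andP => _ /forallP run_ij le_k.
have lt_kn : k < n by case/andP: le_k => _ /leq_ltn_trans; apply.
by have := run_ij (Ordinal lt_kn); rewrite le_k (tnth_nth false).
Qed.

(** Cut [w] before [i] and after [j]: the middle piece consists of ones only. *)
Lemma run_count w (i j : 'I_n) : is_run w i j -> j - i + 1 <= count id w.
Proof.
move=> run_ij; have le_ij : i <= j by case/andP: run_ij.
have lt_jn := ltn_ord j.
rewrite -(cat_take_drop i w) count_cat -(cat_take_drop (j - i + 1) (drop i w)).
rewrite count_cat; set s := take _ (drop _ _).
have size_s : size s = j - i + 1.
  by rewrite size_takel // size_drop size_tuple; lia.
suff: all id s by rewrite all_count => /eqP; lia.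
apply/(all_nthP false) => k; rewrite size_s => lt_k.
by rewrite nth_take // nth_drop; apply: (run_nth run_ij); lia.
Qed.

(** A longest run among those containing [i, j] is maximal for inclusion. *)
Lemma run_in_block w (i j : 'I_n) : is_run w i j ->
  exists i', exists j', [/\ is_block w i' j', i' <= i & j <= j'].
Proof.
move=> run_ij.
pose Q := [pred x : 'I_n * 'I_n | [&& x.1 <= i, j <= x.2 & is_run w x.1 x.2]].
have Qij : Q (i, j) by rewrite /Q /= !leqnn.
case: (@arg_maxnP _ (i, j) Q (fun x => x.2 - x.1) Qij) => -[i' j'].
case/and3P => /= le_i le_j run' max'; exists i', j'; split=> //.
rewrite /is_block run' /=; apply/forallP => i2; apply/forallP => j2.
apply/implyP => /and3P[le_i2 le_j2 run2].
have := max' (i2, j2); rewrite /=.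
rewrite (leq_trans le_i2) // (leq_trans le_j) //= run2.
move/(_ isT) => le_len; have le_ij' : i' <= j' by case/andP: run'.
by rewrite -!val_eqE /=; lia.
Qed.

Lemma I_word_run w a l : I_word p r w -> 0 < l ->
  (forall k, a <= k < a + l -> nth false w k) -> l <= r.
Proof.
case/andP => /forallP len_w _ l_gt0 ones.
have lt_n k : a <= k < a + l -> k < n.
  by move/ones/nth_true_lt.
have lt_an : a < n by apply: lt_n; lia.
have lt_bn : a + l.-1 < n by apply: lt_n; lia.
have /run_in_block[i [j [block_ij /= le_i le_j]]] :
    is_run w (Ordinal lt_an) (Ordinal lt_bn).
  rewrite /is_run /= leq_addr /=; apply/forallP => k; apply/implyP => le_k.
  by rewrite (tnth_nth false); apply: ones; lia.
have /forallP/(_ j) := len_w i; rewrite block_ij /=; lia.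
Qed.

(** A zero at a + 1 would be the only one between a block ending at a and a block starting at a +
    2. *)
Lemma I_word_gap w a : 1 < p -> I_word p r w ->
  nth false w a -> nth false w a.+2 -> nth false w a.+1.
Proof.
move=> p_gt1 /andP[_ /forallP sep_w] wa wa2; apply: contraT => wa1.
have lt_a2 : a.+2 < n := nth_true_lt wa2.
have lt_a : a < n by lia.
have run1 (k : 'I_n) : nth false w k -> is_run w k k.
  move=> wk; rewrite /is_run leqnn; apply/forallP => k'; apply/implyP.
  by rewrite -eqn_leq => /eqP/val_inj <-; rewrite (tnth_nth false).
have /run_in_block[i1 [j1 [block1 /= le_i1 le_j1]]] := run1 (Ordinal lt_a) wa.
have /run_in_block[i2 [j2 [block2 /= le_i2 le_j2]]] := run1 (Ordinal lt_a2) wa2.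
have eq_j1 : j1 = a :> nat.
  apply/eqP; rewrite eqn_leq le_j1 andbT leqNgt; apply: contra wa1 => lt_j1.
  by case/andP: block1 => run1' _; apply: (run_nth run1'); lia.
have eq_i2 : i2 = a.+2 :> nat.
  apply/eqP; rewrite eqn_leq le_i2 /= ltnNge; apply: contra wa1 => lt_i2.
  by case/andP: block2 => run2' _; apply: (run_nth run2'); lia.
have /forallP/(_ j1)/forallP/(_ i2)/forallP/(_ j2) := sep_w i1.
rewrite block1 block2 eq_j1 eq_i2 leqnSn /= => le_p.
have lt_a1 : a.+1 < n by lia.
have : zeros_between w j1 i2 <= #|[set Ordinal lt_a1]|.
  apply: subset_leq_card; apply/subsetP => k.
  by rewrite !inE -val_eqE /= => /andP[+ _]; lia.
rewrite cards1; lia.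
Qed.

(** The ones form at most one block; this pointwise form can be checked by comparing positions. *)
Definition convex_word w :=
  forall i k j, i < k < j -> nth false w i -> nth false w j -> nth false w k.

(** A block is no longer than the number of ones. Two distinct blocks have a zero between them,
    which suffices if p <= 1 and contradicts convexity otherwise. *)
Lemma I_word_count w :
  p <= 1 \/ convex_word w -> count id w <= r -> I_word p r w.
Proof.
move=> sep_w le_wr; apply/andP; split.
  apply/forallP => i; apply/forallP => j; apply/implyP => /andP[run_ij _].
  exact: leq_trans (run_count run_ij) _.
apply/forallP => i1; apply/forallP => j1.
apply/forallP => i2; apply/forallP => j2.
apply/implyP => /and3P[/andP[run1 max1] /andP[run2 _] lt_ji].
have [le_ij1 le_ij2] : i1 <= j1 /\ i2 <= j2.
  by case/andP: run1 => -> _; case/andP: run2.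
have [k lt_k wk] : exists2 k : 'I_n, j1 < k < i2 & ~~ tnth w k.
  (* Without such a zero, [i1, j2] would be a run properly containing the block [i1, j1]. *)
  apply/exists_inP; apply: contraT => /exists_inPn no_zero.
  have /forallP/(_ i1)/forallP/(_ j2) := max1.
  rewrite leqnn -!val_eqE /= eqxx /= (_ : j1 <= j2) /=; last by lia.
  rewrite (_ : is_run w i1 j2); first by move/eqP; lia.
  rewrite /is_run; apply/andP; split; first by lia.
  apply/forallP => k; apply/implyP => le_k.
  have [le_kj1 | lt_j1k] := leqP k j1.
    by rewrite (tnth_nth false); apply: (run_nth run1); lia.
  have [le_i2k | lt_ki2] := leqP i2 k.
    by rewrite (tnth_nth false); apply: (run_nth run2); lia.
  by apply/negbNE/no_zero; rewrite unfold_in lt_j1k.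
case: sep_w => [le_p1 | convex_w].
  apply: leq_trans le_p1 _; apply/card_gt0P; exists k.
  by rewrite inE lt_k.
move/negP: wk; case; rewrite (tnth_nth false); apply: (convex_w _ _ _ lt_k).
  by apply: (run_nth run1); rewrite le_ij1 leqnn.
by apply: (run_nth run2); rewrite le_ij2 leqnn.
Qed.

Lemma I_word_flip_zero (i : 'I_n) : 0 < r -> I_word p r (flip (zero_word n) i).
Proof.
move=> r_gt0; apply: I_word_count; last first.
  by rewrite (leq_trans (count_flip _ _)) ?count_zero_word.
by right=> a k b; rewrite !nth_flip !nth_zero_word !addbF; lia.
Qed.

(** * Words of the I-graph all of whose flips are legal *)

Section AllFlips.
Variable w : n.-tuple bool.
Hypotheses (Iw : I_word p r w) (all_flips : forall i, I_word p r (flip w i)).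

Lemma all_flips_nth a : a < n ->
  exists2 u : n.-tuple bool, I_word p r u &
    forall k, nth false u k = (k == a) (+) nth false w k.
Proof.
by move=> lt_an; exists (flip w (Ordinal lt_an)) => // k; rewrite nth_flip.
Qed.

(** The position just after the run is a 1 or can be flipped to one, which yields a legal run of
    length l + 1. *)
Lemma I_all_flips_run a l : a + l < n ->
  (forall k, a <= k < a + l -> nth false w k) -> l < r.
Proof.
move=> lt_n ones; case wl: (nth false w (a + l)).
  apply: (@I_word_run w a) => // k le_k.
  by have [-> // | ne_k] := eqVneq k (a + l); apply: ones; lia.
have [u Iu uE] := all_flips_nth lt_n.
apply: (@I_word_run u a) => // k le_k; rewrite uE.
by have [-> | ne_k] := eqVneq k (a + l); [rewrite wl | apply: ones; lia].
Qed.

Lemma I_all_flips_run_left a l :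
  (forall k, a.+1 <= k < a.+1 + l -> nth false w k) -> a < n -> l < r.
Proof.
move=> ones lt_n; case wa: (nth false w a).
  apply: (@I_word_run w a) => // k le_k.
  by have [-> // | ne_k] := eqVneq k a; apply: ones; lia.
have [u Iu uE] := all_flips_nth lt_n.
apply: (@I_word_run u a) => // k le_k; rewrite uE.
by have [-> | ne_k] := eqVneq k a; [rewrite wa | apply: ones; lia].
Qed.

Lemma I_all_flips_r1 : 1 < n -> r = 1 -> w = zero_word n.
Proof.
move=> n_gt1 r1; apply: eq_zero_word => a; apply/negP => wa.
have lt_an := nth_true_lt wa.
have one k : a <= k < a + 1 -> nth false w k.
  by move=> le_k; rewrite (_ : k = a) //; lia.
case: a => [|a] in wa lt_an one *.
  by have := @I_all_flips_run 0 1 n_gt1 one; lia.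
by have := I_all_flips_run_left one (ltnW lt_an); lia.
Qed.

Hypothesis p_gt1 : 1 < p.

(** Two such ones enclose a 1, and flipping this 1 would create 101. *)
Lemma I_all_flips_gap a : nth false w a -> ~~ nth false w a.+2.
Proof.
move=> wa; apply/negP => wa2; have lt_a2 := nth_true_lt wa2.
have [u Iu uE] := all_flips_nth (ltnW lt_a2).
have := I_word_gap p_gt1 Iu; move/(_ a); rewrite !uE wa wa2 eqxx.
rewrite (I_word_gap p_gt1 Iw wa wa2) ltn_eqF // gtn_eqF //.
by move=> /(_ isT isT).
Qed.

(** Position a + 2 holds a zero; flipping it would create 101 if a + 1 held a zero too. *)
Lemma I_all_flips_next a : a.+2 < n -> nth false w a -> nth false w a.+1.
Proof.
move=> lt_a2 wa; have [u Iu uE] := all_flips_nth lt_a2.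
have := I_word_gap p_gt1 Iu; move/(_ a).
rewrite !uE wa eqxx (negbTE (I_all_flips_gap wa)).
by rewrite !ltn_eqF //; apply.
Qed.

Lemma I_all_flips_prev a : nth false w a.+2 -> nth false w a.+1.
Proof.
move=> wa2; have lt_a2 := nth_true_lt wa2.
have wa : nth false w a = false.
  by apply/negP => /I_all_flips_gap; rewrite wa2.
have [u Iu uE] := all_flips_nth (ltnW (ltnW lt_a2)).
have := I_word_gap p_gt1 Iu; move/(_ a).
by rewrite !uE wa wa2 eqxx !gtn_eqF //; apply.
Qed.

(** Since n > 3, a 1 has a position at distance 2 on some side, hence a neighbouring 1. The
    resulting 11 has a position next to it, where a flip would allow 111. *)
Lemma I_all_flips_r2 : 3 < n -> r = 2 -> w = zero_word n.
Proof.
move=> n_gt3 r2; apply: eq_zero_word => a; apply/negP => wa.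
have lt_an := nth_true_lt wa.
have no11 b : nth false w b -> nth false w b.+1 -> False.
  move=> wb wb1; have lt_b1 := nth_true_lt wb1.
  have ones k : b <= k < b + 2 -> nth false w k.
    move=> le_k; have [-> // | ne_k] := eqVneq k b.
    by rewrite (_ : k = b.+1) //; lia.
  case: b => [|b] in wb wb1 lt_b1 ones *.
    by have := @I_all_flips_run 0 2 (ltnW n_gt3) ones; lia.
  by have := I_all_flips_run_left ones (ltnW (ltnW lt_b1)); lia.
have [lt_a2 | le_n] := ltnP a.+2 n.
  exact: no11 wa (I_all_flips_next lt_a2 wa).
case: a => [|[|a]] in wa lt_an le_n *; [lia | lia |].
exact: no11 (I_all_flips_prev wa) wa.
Qed.

Lemma I_all_flips_n_gt4 : 4 < n -> w = zero_word n.
Proof.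
move=> n_gt4; apply: eq_zero_word => a; apply/negP => wa.
(* A 1 at b + 3 spreads left to b + 2 and b + 1, but ones at distance 2 are excluded. *)
have not_prev b : ~~ nth false w b.+3.
  apply/negP => wb3; have wb1 := I_all_flips_prev (I_all_flips_prev wb3).
  by have := I_all_flips_gap wb1; rewrite wb3.
have lt_a3 : a < 3.
  by rewrite ltnNge; apply/negP => le_a; have := not_prev (a - 3);
     rewrite (_ : (a - 3).+3 = a) ?wa //; lia.
have wa1 : nth false w a.+1 by apply: I_all_flips_next => //; lia.
have := I_all_flips_gap wa.
(* If a + 3 < n, the ones spread right to a + 2, at distance 2 from a. Otherwise a = 2 and n = 5,
   and the 1 at a + 1 = 3 is excluded by [not_prev]. *)
have [le_a3 | lt_n] := leqP n a.+3; last by rewrite (I_all_flips_next _ wa1).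
by have := not_prev 0; rewrite (_ : 3 = a.+1) ?wa1 //; lia.
Qed.

End AllFlips.

End IWords.

Theorem theorem5p1 (p r n : nat) (hp : 1 <= p) (hr : 1 <= r) (hn : 2 <= n) :
  (max_degree (OGamma n p r) = n /\ max_degree (IGamma n p r) = n) /\
  (degree (O_zero n p r) = n /\ degree (I_zero n p r) = n) /\
  ((forall v : OGamma n p r,
      degree v = max_degree (OGamma n p r) <-> v = O_zero n p r) <->
   ((1 <= p /\ r = 1 /\ 2 <= n) \/
    (2 <= p /\ 2 <= r /\ 2 <= n))) /\
  ((forall v : IGamma n p r,
      degree v = max_degree (IGamma n p r) <-> v = I_zero n p r) <->
   ((1 <= p /\ r = 1 /\ 2 <= n) \/
    (2 <= p /\ r = 2 /\ 4 <= n) \/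
    (2 <= p /\ 3 <= r /\ 5 <= n))).
Proof.
have degO : degree (O_zero n p r) = n.
  by apply/degree_eq_n => i; apply: O_word_flip_zero.
have degI : degree (I_zero n p r) = n.
  by apply/degree_eq_n => i; apply: I_word_flip_zero.
rewrite (max_degree_eq_n degO) (max_degree_eq_n degI).
have uniqO := unique_degree_eq_n degO; have uniqI := unique_degree_eq_n degI.
have lt0n : 0 < n := ltnW hn.
have count_e (i j : 'I_n) : count id (flip (flip (zero_word n) i) j) <= 2.
  apply: leq_trans (count_flip _ _) _.
  by rewrite ltnS -(count_zero_word n) count_flip.
split=> //; split=> //; split.
  split=> [/uniqO uniq0 | cond]; last first.
    by apply/uniqO => w; apply: O_all_flips => //; lia.
  suff: ~ (p = 1 /\ 1 < r) by lia.
  (* The witness is 10^(n-1): for p = 1 < r, every word with at most two ones is legal. *)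
  case=> p1 r_gt1; apply: (@flip_zero_neq n (Ordinal lt0n)); apply: uniq0.
    exact: O_word_flip_zero.
  by move=> i; apply: O_word_count => //; apply: leq_trans (count_e _ _) _.
split=> [/uniqI uniq0 | cond]; last first.
  apply/uniqI => w Iw all_flips.
  case: cond => [[_ [r1 _]] | [[p_gt1 [r2 n_gt3]] | [p_gt1 [_ n_gt4]]]].
  - exact: I_all_flips_r1 all_flips _ _.
  - exact: I_all_flips_r2 all_flips _ _ _.
  - exact: I_all_flips_n_gt4 all_flips _ _.
have no1 : ~ (p = 1 /\ 1 < r).
  case=> p1 r_gt1; apply: (@flip_zero_neq n (Ordinal lt0n)); apply: uniq0.
    exact: I_word_flip_zero.
  move=> i; apply: I_word_count; first by left; rewrite p1.
  exact: leq_trans (count_e _ _) _.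
have no3 : ~ (n <= 3 /\ 1 < r).
  (* The witness is 01 or 010, with its 1 at index 1: every other position is next to it, so all
     flips stay convex. *)
  case=> n_le3 r_gt1; apply: (@flip_zero_neq n (Ordinal hn)); apply: uniq0.
    exact: I_word_flip_zero.
  move=> i; apply: I_word_count; last exact: leq_trans (count_e _ _) _.
  right=> a k b lt_akb; rewrite !nth_flip !nth_zero_word !addbF /=.
  have := ltn_ord i.
  (* Each of the three positions [a], [k], [b] is compared with the two flipped ones. *)
  by do 6!case: eqP => ? //=; lia.
have no4 : ~ (n = 4 /\ 2 < r).
  case=> n4 r_gt2; have lt2n : 2 < n by rewrite n4.
  (* This is 0110; its flips 1110, 0010, 0100 and 0111 are convex with at most three ones. *)
  pose e12 := flip (flip (zero_word n) (Ordinal hn)) (Ordinal lt2n).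
  have : e12 = zero_word n.
    apply: uniq0 => [|i]; apply: I_word_count.
    - right=> a k b lt_akb; rewrite !nth_flip !nth_zero_word !addbF /=.
      by do 6!case: eqP => ? //=; lia.
    - exact: leq_trans (count_e _ _) (ltnW _).
    - right=> a k b lt_akb; rewrite !nth_flip !nth_zero_word !addbF /=.
      have := ltn_ord i.
      by do 9!case: eqP => ? //=; lia.
    - apply: leq_trans (count_flip _ _) _.
      by apply: leq_trans r_gt2; rewrite ltnS count_e.
  move/(congr1 (fun w : n.-tuple bool => nth false w 1)).
  by rewrite !nth_flip nth_zero_word.
(* If r >= 2, the three exclusions leave p >= 2 and n >= 4, with n >= 5 once r >= 3. *)
lia.
Qed.
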